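(* Any formula of inclusion logic is equivalent to some formula of equiextension logic, and any formula of equiextension logic is equivalent to some formula of inclusion logic. Here formulas $\phi,\phi'$ are equivalent if $M\models_X\phi\Leftrightarrow M\models_X\phi'$ for all models $M$ of the relevant signature and all teams $X$ over $M$ whose domain contains the free variables of both formulas.
   Context: All first order models are assumed to have at least two elements in their domain; $\mathrm{Dom}(M)$ is the domain of $M$. An assignment over $M$ is a function from a set of variables to $\mathrm{Dom}(M)$; $s[m/x]$ is the assignment which sends $x$ to $m$ and otherwise agrees with $s$; $t\langle s\rangle$ is the value of the term $t$ in $M$ under $s$, and $\vec t\langle s\rangle$ is the corresponding tuple of values. A team $X$ over $M$ is a set of assignments over $M$ all having the same domain, called the domain of $X$. For a tuple of terms $\vec t$, $X(\vec t)=\{\vec t\langle s\rangle : s\in X\}$. All formulas are in negation normal form and are built using $\wedge,\vee,\exists x,\forall x$ from first order literals together with: for inclusion logic, inclusion atoms $\vec t_1\subseteq\vec t_2$; for equiextension logic, equiextension atoms $\vec t_1\bowtie\vec t_2$ (in both cases $\vec t_1,\vec t_2$ are finite tuples of terms of the same length). The satisfaction relation $M\models_X\phi$ (lax team semantics), where the domain of $X$ contains the free variables of $\phi$, is: - for a first order literal $\phi$: $M\models_s\phi$ (Tarski) for all $s\in X$; - $M\models_X \vec t_1\subseteq\vec t_2$ iff for every $s\in X$ there is $s'\in X$ with $\vec t_1\langle s\rangle=\vec t_2\langle s'\rangle$; - $M\models_X \vec t_1\bowtie\vec t_2$ iff $X(\vec t_1)=X(\vec t_2)$; - $M\models_X\psi\vee\theta$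 iff $X=Y\cup Z$ for some teams $Y,Z$ with $M\models_Y\psi$ and $M\models_Z\theta$; - $M\models_X\psi\wedge\theta$ iff $M\models_X\psi$ and $M\models_X\theta$; - $M\models_X\exists x\psi$ iff there is $H:X\to\mathcal P(\mathrm{Dom}(M))\setminus\{\emptyset\}$ with $M\models_{X[H/x]}\psi$, where $X[H/x]=\{s[m/x]:s\in X,\ m\in H(s)\}$; - $M\models_X\forall x\psi$ iff $M\models_{X[M/x]}\psi$, where $X[M/x]=\{s[m/x]:s\in X,\ m\in\mathrm{Dom}(M)\}$. *)

(* Defs.v *)
From mathcomp Require Import all_boot.
From mathcomp Require Import boolp classical_sets.
Set Implicit Arguments.
Unset Strict Implicit.
Unset Printing Implicit Defensive.

Local Open Scope classical_set_scope.

(* Constants are 0-ary function symbols; variables are natural numbers. *)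
Record signature := Signature {
  fsym : Type;
  rsym : Type;
  far : fsym -> nat;
  rar : rsym -> nat
}.

Record model (sig : signature) := Model {
  Dom :> Type;
  fint : forall f : fsym sig, (far f).-tuple Dom -> Dom;
  rint : forall r : rsym sig, (rar r).-tuple Dom -> Prop;
  Dom_two : exists a b : Dom, a <> b
}.

Inductive term (sig : signature) : Type :=
| Var of nat
| App (f : fsym sig) of ('I_(far f) -> term sig).
Arguments Var {sig}.

Inductive literal (sig : signature) : Type :=
| LEq of term sig & term sig
| LNeq of term sig & term sig
| LRel (r : rsym sig) of ('I_(rar r) -> term sig)
| LNRel (r : rsym sig) of ('I_(rar r) -> term sig).

Inductive logic := Inclusion | Equiextension.

(* [Dep t1 t2] is the atom t1 <= t2 when L = Inclusion, and the atom
   t1 |><| t2 when L = Equiextension; see [sat_dep]. *)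
Inductive formula (sig : signature) (L : logic) : Type :=
| Lit of literal sig
| Dep (n : nat) of ('I_n -> term sig) & ('I_n -> term sig)
| And of formula sig L & formula sig L
| Or of formula sig L & formula sig L
| Ex of nat & formula sig L
| All of nat & formula sig L.
Arguments Lit {sig L}.
Arguments Dep {sig L n}.
Arguments Ex {sig L}.
Arguments All {sig L}.

Fixpoint term_fv sig (t : term sig) : set nat :=
  match t with
  | Var x => [set x]
  | App f u => \bigcup_i term_fv (u i)
  end.

Definition tuple_fv sig n (u : 'I_n -> term sig) : set nat :=
  \bigcup_i term_fv (u i).

Definition literal_fv sig (l : literal sig) : set nat :=
  match l with
  | LEq t1 t2 | LNeq t1 t2 => term_fv t1 `|` term_fv t2
  | LRel r u | LNRel r u => tuple_fv u
  end.

Fixpoint fv sig L (phi : formula sig L) : set nat :=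
  match phi with
  | Lit l => literal_fv l
  | Dep n t1 t2 => tuple_fv t1 `|` tuple_fv t2
  | And psi theta | Or psi theta => fv psi `|` fv theta
  | Ex x psi | All x psi => fv psi `\ x
  end.

(* Assignments are partial functions on the variables, [None] meaning
   "undefined". *)
Definition assignment (M : Type) := nat -> option M.

Definition assignment_dom M (s : assignment M) : set nat := [set x | s x].

Definition update M (s : assignment M) (x : nat) (m : M) : assignment M :=
  fun y => if y == x then Some m else s y.

(* The tuple of the values of u if all are defined, and None otherwise:
   pmap skips undefined entries and insub checks that n entries are left. *)
Definition otuple T n (u : 'I_n -> option T) : option (n.-tuple T) :=
  insub (pmap u (enum 'I_n)).

Lemma otupleP T n (u : 'I_n -> option T) (a : n.-tuple T) :
  otuple u = Some a <-> forall i, u i = Some (tnth a i).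
Proof.
have szle r : size (pmap u r) <= size r.
  by rewrite -(size_map u) size_pmap -count_map count_size.
have pmapP r b : size b = size r ->
    pmap u r = b <-> [seq u i | i <- r] = [seq Some c | c <- b].
  elim: r b => [|i r IH] [|c b] //= [sz].
  case: (u i) => [d|] /=; last first.
    split=> // h; have := szle r; by rewrite h /= sz ltnn.
  by split=> [[-> /IH ->]|[-> /IH ->]].
have {}pmapP : pmap u (enum 'I_n) = a <-> forall i, u i = Some (tnth a i).
  rewrite pmapP; last by rewrite size_tuple size_enum_ord.
  rewrite -{1}(map_tnth_enum a).
  rewrite -map_comp; split=> [h i|h]; last exact: eq_map.
  have := congr1 (fun r => nth None r i) h.
  by rewrite 2?(nth_map i) ?size_enum_ord// nth_ord_enum.
rewrite -pmapP /otuple; split; last by move=> ->; rewrite valK.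
by case: insubP => // b _ <- [->].
Qed.

Fixpoint value sig (M : model sig) (s : assignment M) (t : term sig)
    : option M :=
  match t with
  | Var x => s x
  | App f u => omap (@fint sig M f) (otuple (fun i => value s (u i)))
  end.

Definition tuple_value sig (M : model sig) (s : assignment M) n
    (u : 'I_n -> term sig) : option (n.-tuple M) :=
  otuple (fun i => value s (u i)).

Definition sat_literal sig (M : model sig) (s : assignment M)
    (l : literal sig) : Prop :=
  match l with
  | LEq t1 t2 => exists a1 a2,
      [/\ value s t1 = Some a1, value s t2 = Some a2 & a1 = a2]
  | LNeq t1 t2 => exists a1 a2,
      [/\ value s t1 = Some a1, value s t2 = Some a2 & a1 <> a2]
  | LRel r u => exists2 a, tuple_value s u = Some a & rint a
  | LNRel r u => exists2 a, tuple_value s u = Some a & ~ rint a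
  end.

Definition is_team M (V : set nat) (X : set (assignment M)) : Prop :=
  forall s, X s -> assignment_dom s = V.

Definition team_values sig (M : model sig) (X : set (assignment M)) n
    (u : 'I_n -> term sig) : set (option (n.-tuple M)) :=
  [set tuple_value s u | s in X].

Definition sat_dep sig (M : model sig) (X : set (assignment M)) (L : logic) n
    (t1 t2 : 'I_n -> term sig) : Prop :=
  match L with
  | Inclusion => forall s, X s ->
      exists2 s', X s' & tuple_value s t1 = tuple_value s' t2
  | Equiextension => team_values X t1 = team_values X t2
  end.

Definition team_supplement M (X : set (assignment M)) (x : nat)
    (H : assignment M -> set M) : set (assignment M) :=
  [set s' | exists s m, [/\ X s, H s m & s' = update s x m]].

Definition team_duplicate M (X : set (assignment M)) (x : nat)
    : set (assignment M) :=
  [set s' | exists s m, X s /\ s' = update s x m].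

(* In the existential case only the values of H on X matter. *)
Fixpoint sat sig L (M : model sig) (X : set (assignment M))
    (phi : formula sig L) : Prop :=
  match phi with
  | Lit l => forall s, X s -> sat_literal s l
  | Dep n t1 t2 => sat_dep X L t1 t2
  | And psi theta => sat X psi /\ sat X theta
  | Or psi theta => exists Y Z, [/\ X = Y `|` Z, sat Y psi & sat Z theta]
  | Ex x psi => exists H : assignment M -> set M,
      (forall s, X s -> H s !=set0) /\ sat (team_supplement X x H) psi
  | All x psi => sat (team_duplicate X x) psi
  end.

Definition equivalent sig L L' (phi : formula sig L) (phi' : formula sig L')
    : Prop :=
  forall (M : model sig) (V : set nat) (X : set (assignment M)),
    is_team V X -> fv phi `<=` V -> fv phi' `<=` V ->
    (sat X phi <-> sat X phi').

(* Main.v *)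
From mathcomp Require Import all_boot.
From mathcomp Require Import boolp classical_sets.
Require Import Defs.

(* An equiextension atom is the conjunction of the two opposite inclusion
   atoms. Conversely, t1 <= t2 holds in a team iff X(t1) `|` X(t2) = X(t2).
   The formula
     All u v, Ex z, ((u = v /\ z = t1) \/ (u <> v /\ z = t2)) /\ z |><| t2,
   with u, v, z fresh, expresses this: since models have at least two elements,
   both cases occur for every assignment of the team, so z ranges exactly over
   X(t1) `|` X(t2). Equivalence is a congruence for the connectives and
   quantifiers, so it is enough to translate atoms. *)

Set Implicit Arguments.
Unset Strict Implicit.
Unset Printing Implicit Defensive.

Local Open Scope classical_set_scope.

(** * Values of terms and bounds on their variables *)

Lemma otuple_defined T n (u : 'I_n -> option T) :
  (forall i, exists a, u i = Some a) -> exists a, otuple u = Some a.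
Proof.
move=> /choice[f uf]; exists [tuple f i | i < n]; apply/otupleP => i.
by rewrite tnth_mktuple.
Qed.

Section Terms.
Variables (sig : signature) (M : model sig).
Implicit Types (s : assignment M) (t : term sig).

Lemma value_defined s t :
  term_fv t `<=` assignment_dom s -> exists a, value s t = Some a.
Proof.
elim: t => [x|f u IH] /= sub.
  have := sub x erefl; rewrite /assignment_dom /=.
  by case: (s x) => // a; exists a.
have [i|a ->] := @otuple_defined _ _ (fun i => value s (u i)).
  by apply: IH => y uy; apply: sub; exists i.
by exists (fint a).
Qed.

Lemma value_agree s s' t :
  (forall x, term_fv t x -> s x = s' x) -> value s t = value s' t.
Proof.
elim: t => [x|f u IH] /= ss'; first exact: ss'.
congr (omap _ (otuple _)); apply/funext => i.
by apply: IH => x ux; apply: ss'; exists i.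
Qed.

Lemma tuple_value_agree s s' n (t : 'I_n -> term sig) :
  (forall x, tuple_fv t x -> s x = s' x) -> tuple_value s t = tuple_value s' t.
Proof.
move=> ss'; congr otuple; apply/funext => i.
by apply: value_agree => x tx; apply: ss'; exists i.
Qed.

Lemma sat_LEq s t t' : sat_literal s (LEq t t') -> value s t = value s t'.
Proof. by move=> [a [b [-> -> ->]]]. Qed.

End Terms.

(** Arities are finite, so bounds for the arguments have a maximum. This is the source of fresh
    variables. *)
Lemma bounded_bigcup n (F : 'I_n -> set nat) :
  (forall i, exists N, forall x, F i x -> x < N) ->
  exists N, forall x, (\bigcup_i F i) x -> x < N.
Proof.
move=> /choice[N FN]; exists (\max_i N i) => x [i _ /FN xi].
exact: leq_trans xi (leq_bigmax i).
Qed.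

Lemma term_fv_bounded sig (t : term sig) :
  exists N, forall x, term_fv t x -> x < N.
Proof.
elim: t => [x|f u IH]; first by exists x.+1 => y /= ->.
exact: bounded_bigcup.
Qed.

Lemma tuple_fv_bounded sig n (t : 'I_n -> term sig) :
  exists N, forall x, tuple_fv t x -> x < N.
Proof. by apply: bounded_bigcup => i; exact: term_fv_bounded. Qed.

(** * Variants of assignments and of teams *)

Section Teams.
Variable M : Type.
Implicit Types (s : assignment M) (X Y : set (assignment M)) (xs : seq nat).

(** The relation is asymmetric: on [xs], [s] may be undefined or hold old values that quantification
    overwrites, while [s'] must be defined. *)
Definition is_variant xs s s' :=
  (forall x, x \notin xs -> s x = s' x) /\ (forall x, x \in xs -> s' x).

(** The effect of a whole block of lax existential quantifiers: the first clause reflects that the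
    chosen sets of values are nonempty, the second that every new assignment comes from an old
    one. *)
Definition team_variant xs X X' :=
  (forall s, X s -> exists2 s', X' s' & is_variant xs s s') /\
  (forall s', X' s' -> exists2 s, X s & is_variant xs s s').

Lemma update_dom s x m :
  assignment_dom (update s x m) = assignment_dom s `|` [set x].
Proof.
apply/seteqP; split=> y; rewrite /assignment_dom /update /=.
  by case: eqP => [->|_]; [right|left].
by case: eqP => // ? [].
Qed.

Lemma supplement_is_team V X x H :
  is_team V X -> is_team (V `|` [set x]) (team_supplement X x H).
Proof. by move=> tX _ [s [m [/tX <- _ ->]]]; exact: update_dom. Qed.

Lemma duplicate_is_team V X x :
  is_team V X -> is_team (V `|` [set x]) (team_duplicate X x).
Proof. by move=> tX _ [s [m [/tX <- ->]]]; exact: update_dom. Qed.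

(** The final value [m] of [x] can serve as its first choice: if [x] recurs in [xs], that choice is
    overwritten anyway. *)
Lemma is_variant_cons x xs s s' m : s' x = Some m ->
  is_variant (x :: xs) s s' -> is_variant xs (update s x m) s'.
Proof.
move=> s'x [off on]; split=> [y yxs|y yxs]; last by rewrite on// inE yxs orbT.
by rewrite /update; case: eqP => [->//|/eqP yx]; rewrite off// inE negb_or yx.
Qed.

Lemma is_variant_uncons x xs s s' m :
  is_variant xs (update s x m) s' -> is_variant (x :: xs) s s'.
Proof.
move=> [off on]; split=> y; rewrite inE.
  by rewrite negb_or => /andP[/negPf yx /off <-]; rewrite /update yx.
case yxs: (y \in xs); first by move=> _; exact: on.
by rewrite orbF => yx; rewrite -off ?yxs// /update yx.
Qed.

End Teams.

(** * Quantifier blocks, conjunctions of literals, and blocks of values *)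

Definition Exs sig L (xs : seq nat) (phi : formula sig L) : formula sig L :=
  foldr Ex phi xs.

(* Thanks to lax semantics no freshness assumption on [xs] is needed. *)
Lemma sat_Exs sig L (M : model sig) xs (phi : formula sig L)
    (X : set (assignment M)) :
  sat X (Exs xs phi) <-> exists2 X', team_variant xs X X' & sat X' phi.
Proof.
elim: xs X => [|x xs IH] X /=.
  split=> [sX|[X' [XX' X'X]]].
    by exists X => //; split=> s Xs; exists s.
  suff -> : X = X' by [].
  apply/seteqP; split=> s.
    move=> /XX'[s' X's' [off _]]; rewrite (_ : s = s')//.
    by apply/funext => y; exact: off.
  move=> /X'X[s' X's' [off _]]; rewrite (_ : s = s')//.
  by apply/funext => y; rewrite off.
split=> [[H [H0 /IH[X' [XX' X'X] sX']]]|[X' [XX' X'X] sX']].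
  exists X' => //; split=> [s Xs|s' /X'X[_ [s [m [Xs Hm ->]]]] v].
    have [m Hm] := H0 _ Xs.
    have [|s' X's' v] := XX' (update s x m); first by exists s, m.
    by exists s' => //; exact: is_variant_uncons v.
  by exists s => //; exact: is_variant_uncons v.
(* [H s] collects the values at [x] of all variants of [s] in [X']; lax semantics allows several. *)
exists (fun s => [set m |
  exists s', [/\ X' s', is_variant (x :: xs) s s' & s' x = Some m]]).
have definedP (s s' : assignment M) :
    is_variant (x :: xs) s s' -> exists m, s' x = Some m.
  by move=> [_ /(_ x)]; rewrite mem_head;
    case: (s' x) => [m|/(_ isT)//]; exists m.
split=> [s /XX'[s' X's' v]|].
  by have [m s'x] := definedP _ _ v; exists m, s'.
apply/IH; exists X' => //; split=> [_ [s [m [Xs [s' [X's' v s'x]] ->]]]|s' X's'].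
  by exists s' => //; exact: is_variant_cons v.
have [s Xs v] := X'X _ X's'; have [m s'x] := definedP _ _ v.
exists (update s x m); last exact: is_variant_cons v.
by exists s, m; split=> //; exists s'.
Qed.

(** The literal [l0] ends the fold, so no formula for truth is needed when [r] is empty. *)
Definition conj_literals sig L (I : Type) (r : seq I) (l0 : literal sig)
    (l : I -> literal sig) : formula sig L :=
  foldr (fun i phi => And (Lit (l i)) phi) (Lit l0) r.

(** Literals are flat, that is, checked one assignment at a time, and conjunction preserves this. *)
Lemma sat_conj_literals sig L (M : model sig) n l0 (l : 'I_n -> literal sig)
    (X : set (assignment M)) :
  sat X (conj_literals L (enum 'I_n) l0 l) <->
  forall s, X s -> sat_literal s l0 /\ forall i, sat_literal s (l i).
Proof.
have -> : sat X (conj_literals L (enum 'I_n) l0 l) <->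
    forall s, X s ->
      sat_literal s l0 /\ forall i, i \in enum 'I_n -> sat_literal s (l i).
  elim: (enum 'I_n) => [|j r IH] /=.
    by split=> h s /h //; case.
  rewrite IH; split=> [[hj hr] s Xs|h].
    split=> [|i]; first by have [] := hr _ Xs.
    by rewrite inE => /predU1P[->|ir];
      [exact: hj|have [_ /(_ i ir)] := hr _ Xs].
  split=> s /h[h0 hr]; first by apply: hr; rewrite mem_head.
  by split=> // i ir; apply: hr; rewrite inE ir orbT.
split=> h s /h[h0 hr]; split=> // i.
by apply: hr; rewrite mem_enum.
Qed.

(** The test [x < k] is there because truncated subtraction would send every smaller [x] to index
    0. *)
Definition overwrite (M : Type) n (k : nat) (w : 'I_n -> option M)
    (s : assignment M) : assignment M :=
  fun x => if x < k then s x else if insub (x - k) is Some i then w i else s x.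

Lemma overwrite_id M n k (w : 'I_n -> option M) s (i : 'I_n) :
  overwrite k w s (k + i) = w i.
Proof. by rewrite /overwrite ltnNge leq_addr /= addKn valK. Qed.

Lemma overwrite_variant M n k (w : 'I_n -> option M) s : (forall i, w i) ->
  is_variant (iota k n) s (overwrite k w s).
Proof.
move=> w_def; split=> x; rewrite mem_iota /overwrite.
  by case: (ltnP x k) => //= kx; case: insubP => // i + _;
    rewrite ltn_subLR// => ->.
by case: (ltnP x k) => //= kx xk; rewrite insubT ?ltn_subLR.
Qed.

(** * Translation of an inclusion atom *)

Section InclusionAtom.
Variables (sig : signature) (n k : nat) (t1 t2 : 'I_n -> term sig).

Let u : term sig := Var k.
Let v : term sig := Var k.+1.
Let z (i : 'I_n) : term sig := Var (k.+2 + i).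

Definition equiext_of_incl : formula sig Equiextension :=
  All k (All k.+1 (Exs (iota k.+2 n)
    (And (Or (conj_literals _ (enum 'I_n) (LEq u v) (fun i => LEq (z i) (t1 i)))
             (conj_literals _ (enum 'I_n) (LNeq u v) (fun i => LEq (z i) (t2 i))))
         (Dep z t2)))).

Hypotheses (fresh1 : forall x, tuple_fv t1 x -> x < k)
           (fresh2 : forall x, tuple_fv t2 x -> x < k).

Lemma equiext_of_inclP :
  equivalent (Dep t1 t2 : formula sig Inclusion) equiext_of_incl.
Proof.
move=> M V X tX fvV _.
pose ext (s : assignment M) a b := update (update s k a) k.+1 b.
have duplP s' : team_duplicate (team_duplicate X k) k.+1 s' <->
    exists s a b, X s /\ s' = ext s a b.
  split=> [[_ [b [[s [a [Xs ->]]] ->]]]|[s [a [b [Xs ->]]]]].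
    by exists s, a, b.
  by exists (update s k a), b; split=> //; exists s, a.
have extu s a b : ext s a b k = Some a.
  by rewrite /ext /update eqxx; case: eqP => // /eqP; rewrite ltn_eqF.
have extv s a b : ext s a b k.+1 = Some b by rewrite /ext /update eqxx.
(* The block [z] starts at [k.+2], so choosing it disturbs neither [u], [v] nor the variables of
   [t1] and [t2]. *)
have variant_low s a b s' : is_variant (iota k.+2 n) (ext s a b) s' ->
    [/\ s' k = Some a, s' k.+1 = Some b & forall x, x < k -> s x = s' x].
  move=> [off _].
  have low x : x < k.+2 -> ext s a b x = s' x.
    by move=> xk; rewrite off// mem_iota leqNgt xk.
  split; rewrite -?low ?extu ?extv// => x xk.
  rewrite -low; last by rewrite (ltn_trans xk).
  by rewrite /ext /update !ltn_eqF// ltnW.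
have tv1 (s s' : assignment M) :
    (forall x, x < k -> s x = s' x) -> tuple_value s t1 = tuple_value s' t1.
  by move=> ss'; apply: tuple_value_agree => x /fresh1; exact: ss'.
have tv2 (s s' : assignment M) :
    (forall x, x < k -> s x = s' x) -> tuple_value s t2 = tuple_value s' t2.
  by move=> ss'; apply: tuple_value_agree => x /fresh2; exact: ss'.
have tvz (t : 'I_n -> term sig) (s : assignment M) :
    (forall i, value s (z i) = value s (t i)) ->
    tuple_value s z = tuple_value s t.
  by move=> zt; congr otuple; apply/funext => i; exact: zt.
split=> [incl|]; last first.
  move=> /= /sat_Exs[X' [XX' X'X] [[Y [Z [X'YZ]]]]].
  move=> /sat_conj_literals hY /sat_conj_literals hZ X'zt2 s Xs.
  (* Giving [u] and [v] the same value rules out the second disjunct, so [z] equals [t1] at [s']. *)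
  have [a [_ _]] := Dom_two M.
  have [|s' X's' /variant_low[s'u s'v ss']] := XX' (ext s a a).
    by apply/duplP; exists s, a, a.
  have : X' s' by [].
  rewrite {1}X'YZ => -[/hY[_ zt1]|/hZ[]]; last first.
    by move=> [? [? []]] /=; rewrite s'u s'v => -[<-] [<-].
  (* The equiextension atom yields [r] in [X'] whose value of [t2] is the value of [z] at [s']; the
     assignment [s0] of [X] from which [r] comes gives [t2] that same value. *)
  have : team_values X' z (tuple_value s' z) by exists s'.
  rewrite X'zt2 => -[r X'r rt2].
  have [_ /duplP[s0 [b [c [Xs0 ->]]]] /variant_low[_ _ s0r]] := X'X _ X'r.
  exists s0 => //; rewrite (tv1 _ _ ss') (tv2 _ _ s0r) rt2.
  by apply/esym/tvz => i; exact: sat_LEq (zt1 i).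
(* Assignments are partial and an equality literal requires both sides to be defined; this is where
   the team domain containing the free variables matters. *)
have defined (s : assignment M) (t : 'I_n -> term sig) i :
    X s -> tuple_fv t `<=` V ->
    (forall x, tuple_fv t x -> x < k) ->
    forall s', (forall x, x < k -> s x = s' x) ->
    exists a, value s' (t i) = Some a.
  move=> Xs tV fresh s' ss'; apply: value_defined => x tx.
  have tx' : tuple_fv t x by exists i.
  by rewrite /assignment_dom /= -ss' ?fresh//;
    have := tV _ tx'; rewrite -(tX _ Xs).
have V1 : tuple_fv t1 `<=` V by move=> x t1x; apply: fvV; left.
have V2 : tuple_fv t2 `<=` V by move=> x t2x; apply: fvV; right.
(* [T True t1] and [T False t2] will witness the two disjuncts; stating the guard as an equality of
   propositions lets one definition serve both. *)
pose T (b : Prop) (t : 'I_n -> term sig) : set (assignment M) :=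
  [set s' | exists s a c, [/\ X s, (a = c) = b,
    is_variant (iota k.+2 n) (ext s a c) s' &
    forall i : 'I_n, s' (k.+2 + i) = value s' (t i)]].
have T_total (t : 'I_n -> term sig) s a c : X s -> tuple_fv t `<=` V ->
    (forall x, tuple_fv t x -> x < k) ->
    exists2 s', T (a = c) t s' & is_variant (iota k.+2 n) (ext s a c) s'.
  move=> Xs tV fresh.
  pose s' := overwrite k.+2 (fun i => value s (t i)) (ext s a c).
  have vs' : is_variant (iota k.+2 n) (ext s a c) s'.
    apply: overwrite_variant => i.
    by have [|d ->] := defined s t i Xs tV fresh s.
  exists s' => //; exists s, a, c; split=> // i; rewrite {1}/s' overwrite_id.
  (* The block stores values of [t] computed at [s]; they are still correct at [s'], which agrees
     with [s] below [k]. *)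
  apply: value_agree => x tx; have [_ _] := variant_low _ _ _ _ vs'; apply.
  by apply: fresh; exists i.
apply/sat_Exs; exists (T True t1 `|` T False t2); first split.
- move=> _ /duplP[s [a [c [Xs ->]]]].
  have [ac|ac] := pselect (a = c).
    have [s' + vs'] := T_total t1 s a c Xs V1 fresh1.
    by rewrite (_ : (a = c) = True) ?propeqE// => Ts'; exists s' => //; left.
  have [s' + vs'] := T_total t2 s a c Xs V2 fresh2.
  by rewrite (_ : (a = c) = False) ?propeqE// => Ts'; exists s' => //; right.
- by move=> s' [] [s [a [c [Xs _ vs' _]]]]; exists (ext s a c) => //;
    apply/duplP; exists s, a, c.
split.
  exists (T True t1), (T False t2); split=> //; apply/sat_conj_literals.
  - move=> s' [s [a [c [Xs ac vs' zt]]]].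
    have [s'u s'v ss'] := variant_low _ _ _ _ vs'; split.
      by exists a, c; split=> //; rewrite ac.
    by move=> i; have [d td] := defined s t1 i Xs V1 fresh1 s' ss';
      exists d, d; split=> //=; rewrite -td -zt.
  - move=> s' [s [a [c [Xs ac vs' zt]]]].
    have [s'u s'v ss'] := variant_low _ _ _ _ vs'; split.
      by exists a, c; split=> //; rewrite ac.
    by move=> i; have [d td] := defined s t2 i Xs V2 fresh2 s' ss';
      exists d, d; split=> //=; rewrite -td -zt.
(* For the inclusion of the values of [t2] in those of [z], two distinct elements [b] and [d] put a
   variant of each [s] into [T False t2], where [z] equals [t2]. *)
apply/seteqP; split=> [_ [s' Ts' <-]|_ [s' Ts' <-]]; last first.
  have [s [a [c [Xs ss']]]] : exists s a c,
      X s /\ is_variant (iota k.+2 n) (ext s a c) s'.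
    by case: Ts' => -[s [a [c [Xs _ vs' _]]]]; exists s, a, c.
  have [_ _ /tv2 <-] := variant_low _ _ _ _ ss'.
  have [b [d bd]] := Dom_two M.
  have [r + /variant_low[_ _ sr]] := T_total t2 s b d Xs V2 fresh2.
  rewrite (_ : (b = d) = False) ?propeqE// => Tr.
  exists r; first by right.
  by rewrite (tv2 _ _ sr); case: Tr => [? [? [? [_ _ _]]]]; exact: tvz.
(* In [T False t2] the assignment [s'] is its own witness. In [T True t1] the inclusion hypothesis
   supplies [s0], and any variant of it in the new team will do. *)
case: Ts' => [[s [a [c [Xs _ /variant_low[_ _ ss'] /tvz zt]]]]|Ts']; last first.
  by exists s'; [right|case: Ts' => [? [? [? [_ _ _ /tvz]]]]].
have [s0 Xs0 st] := incl _ Xs.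
have [b [d bd]] := Dom_two M.
have [r + /variant_low[_ _ s0r]] := T_total t2 s0 b d Xs0 V2 fresh2.
rewrite (_ : (b = d) = False) ?propeqE// => Tr.
by exists r; [right|rewrite zt -(tv1 _ _ ss') -(tv2 _ _ s0r)].
Qed.

End InclusionAtom.

(** * Equiextension atoms and extension to all formulas *)

Lemma incl_of_equiext sig n (t1 t2 : 'I_n -> term sig) :
  equivalent (Dep t1 t2 : formula sig Equiextension)
    (And (Dep t1 t2) (Dep t2 t1) : formula sig Inclusion).
Proof.
move=> M V X _ _ _ /=; split=> [eq12|[incl12 incl21]].
  split=> s Xs.
    have : team_values X t1 (tuple_value s t1) by exists s.
    by rewrite eq12 => -[s' Xs' <-]; exists s'.
  have : team_values X t2 (tuple_value s t2) by exists s.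
  by rewrite -eq12 => -[s' Xs' <-]; exists s'.
apply/seteqP; split=> _ [s Xs <-].
  by have [s' Xs' ->] := incl12 _ Xs; exists s'.
by have [s' Xs' ->] := incl21 _ Xs; exists s'.
Qed.

(** Induction with the same splittings and the same functions [H] on both sides. As [equivalent]
    speaks only of teams with a common, large enough domain, the domain is tracked: splitting keeps
    [V], quantifying over [x] adds [x]. *)
Lemma translate_formula sig L L' :
  (forall n (t1 t2 : 'I_n -> term sig), exists phi' : formula sig L',
     equivalent (Dep t1 t2 : formula sig L) phi') ->
  forall phi : formula sig L, exists phi' : formula sig L', equivalent phi phi'.
Proof.
have subU (A V : set nat) x : A `\ x `<=` V -> A `<=` V `|` [set x].
  move=> AV y Ay; have [->|yx] := eqVneq y x; first by right.
  by left; apply: AV; split=> //; apply/eqP.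
move=> atom; elim=> [l|n t1 t2|psi [psi' e1] theta [theta' e2]
    |psi [psi' e1] theta [theta' e2]|x psi [psi' e]|x psi [psi' e]].
- by exists (Lit l) => M V X _ _ _.
- exact: atom.
- exists (And psi' theta') => M V X tX /=; rewrite !subUset => -[? ?] [? ?].
  by rewrite (e1 M V X)// (e2 M V X).
- exists (Or psi' theta') => M V X tX /=; rewrite !subUset => -[? ?] [? ?].
  have tsub Y Z : X = Y `|` Z -> is_team V Y /\ is_team V Z.
    by move=> XYZ; split=> s h; apply: tX; rewrite XYZ; [left|right].
  split=> -[Y [Z [XYZ sY sZ]]]; have [tY tZ] := tsub _ _ XYZ; exists Y, Z;
    by split=> //; [apply/(e1 M V Y)|apply/(e2 M V Z)].
- exists (Ex x psi') => M V X tX /= /subU ? /subU ?.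
  by split=> -[H [H0 sX]]; exists H; split=> //;
    apply/(e M (V `|` [set x])) => //; exact: supplement_is_team.
- exists (All x psi') => M V X tX /= /subU ? /subU ?.
  by apply: (e M (V `|` [set x])) => //; exact: duplicate_is_team.
Qed.

Theorem corollary4p17 (sig : signature) :
  (forall phi : formula sig Inclusion,
     exists phi' : formula sig Equiextension, equivalent phi phi') /\
  (forall phi : formula sig Equiextension,
     exists phi' : formula sig Inclusion, equivalent phi phi').
Proof.
split; apply: translate_formula => n t1 t2; last first.
  by exists (And (Dep t1 t2) (Dep t2 t1)); exact: incl_of_equiext.
have [N1 b1] := tuple_fv_bounded t1; have [N2 b2] := tuple_fv_bounded t2.
(* All variables of both tuples lie below this maximum, so the new variables can start there. *)
exists (equiext_of_incl (maxn N1 N2) t1 t2); apply: equiext_of_inclP => x.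
  by move=> /b1 xN; rewrite leq_max xN.
by move=> /b2 xN; rewrite leq_max xN orbT.
Qed.
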